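(* Consider the $(\mathsf H,r,M,N)$ combination network with end-user-caches where $N\ge K=\binom{\mathsf H}{r}$. Take any sequence of schemes with uncoded cache placement, with file sizes $B\to\infty$, achieving the optimal max-link load under uncoded placement $R^\star_{\mathrm u}=R^\star_{\mathrm u}(M)$, and let $(x_{\mathcal W})_{\mathcal W\subseteq[K]}$ be any limit point, as $B\to\infty$, of the normalized subfile sizes $$x_{\mathcal W}=\frac{1}{NB}\sum_{i\in[N]}|F_{i,\mathcal W}|,\qquad\mathcal W\subseteq[K].$$ Then, for each subset $\mathcal Q\subseteq[\mathsf H]$ with $|\mathcal Q|\in\{r,\dots,\mathsf H\}$ and each permutation $\mathbf p(\mathcal K_{\mathcal Q})$ of $\mathcal K_{\mathcal Q}$, $$|\mathcal Q|\,R^\star_{\mathrm u}\ \ge\ \sum_{i\in[|\mathcal K_{\mathcal Q}|]}\ \sum_{\mathcal W\subseteq[K]\setminus\{p_1(\mathcal K_{\mathcal Q}),\dots,p_i(\mathcal K_{\mathcal Q})\}}x_{\mathcal W},$$ and moreover $$\sum_{\mathcal W\subseteq[K]}x_{\mathcal W}=1,\qquad\sum_{\mathcal W\subseteq[K]:\,i\in\mathcal W}x_{\mathcal W}\le\frac MN\quad\forall i\in[K].$$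
   Context: Notation: $[n]=\{1,\dots,n\}$. For a finite set $\mathcal J$, $\mathbf p(\mathcal J)=(p_1(\mathcal J),\dots,p_{|\mathcal J|}(\mathcal J))$ denotes a permutation (ordering) of its elements. Network. An $(\mathsf H,r,M,N)$ combination network with end-user-caches ($1\le r\le\mathsf H$, $0\le M\le N$) has one server with $N$ files $F_1,\dots,F_N$, each consisting of $B$ independent uniform bits (files mutually independent), $\mathsf H$ relays without caches, and $K=\binom{\mathsf H}{r}$ users, each connected to a distinct $r$-subset of the relays. The server is connected to every relay. All links are error-free and interference-free. $\mathcal U_h\subseteq[K]$ is the set of users connected to relay $h$, $\mathcal H_k\subseteq[\mathsf H]$ the set of relays connected to user $k$, and $\mathcal K_{\mathcal J}=\{k\in[K]:\mathcal H_k\subseteq\mathcal J\}$ the set of users whose connected relays all lie in $\mathcal J\subseteq[\mathsf H]$. Scheme. In the placement phase user $k$ stores a content $Z_k$ of at most $MB$ bits (a function of the files) without knowing the demands. The placement is uncoded if each $Z_k$ consists of bits copied directly from the files; then $F_{i,\mathcal W}$ denotes the set of bits of $F_i$ stored by exactly the users in $\mathcal W\subseteq[K]$, and $|F_{i,\mathcal W}|$ its number of bits. In the delivery phase user $k$ demands $F_{d_k}$, $d_k\in[N]$; the demand vector $\mathbf d=(d_1,\dots,d_K)$ is known to all nodes. The server sends to relay $h$ a message $X_h$ of $B R_h(\mathbf d)$ bits, and relay $h$ sends to each user $k\in\mathcal U_h$ a message $X_{h\to k}$ (a function of $X_h$) of $B R_{h\to k}(\mathbf d)$ bits. User $k$ must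 recover $F_{d_k}$ from $Z_k$ and $(X_{h\to k}:h\in\mathcal H_k)$ with high probability. The max-link load of a scheme is $\max_{h,\,k\in\mathcal U_h,\,\mathbf d\in[N]^K}\max\{R_h(\mathbf d),R_{h\to k}(\mathbf d)\}$. A load $R$ is achieved for memory $M$ by a sequence of schemes with file sizes $B\to\infty$ if the error probability tends to $0$ and the max-link load has limsup at most $R$. $R^\star_{\mathrm u}(M)$ is the minimum load achievable with uncoded placement. *)

(* Defs.v *)
From HB Require Import structures.
From mathcomp Require Import all_boot all_order all_algebra.
From mathcomp Require Import all_classical all_reals all_analysis.

Set Implicit Arguments.
Unset Strict Implicit.
Unset Printing Implicit Defensive.
Import Order.TTheory GRing.Theory Num.Theory.
Import numFieldNormedType.Exports.
Local Open Scope classical_set_scope.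
Local Open Scope ring_scope.

(* Injectivity into the r-subsets of the H relays is bijectivity, since there
   are exactly 'C(H, r) users. *)
Record combination_network (H r : nat) := CombinationNetwork {
  relays_of : 'I_'C(H, r) -> {set 'I_H};
  relays_of_inj : injective relays_of;
  card_relays_of : forall k, #|relays_of k| = r }.

Definition users_of (H r : nat) (net : combination_network H r) (h : 'I_H) :
  {set 'I_'C(H, r)} := [set k | h \in relays_of net k]%SET.

Definition users_within (H r : nat) (net : combination_network H r)
  (J : {set 'I_H}) : {set 'I_'C(H, r)} :=
  [set k | relays_of net k \subset J]%SET.

Notation files N B := {ffun 'I_N -> B.-tuple bool}.
Notation demands H r N := {ffun 'I_'C(H, r) -> 'I_N}.

(* User k caches the bits at the positions listed in [placement k], where (i, b)
   is bit b of file i; a repeated position counts each time towards the memory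
   used. Loads are recovered from the lengths of the messages, see
   [max_link_load]; [user_msg d h k] is only meaningful when user k is connected
   to relay h. *)
Record uncoded_scheme (R : realType) (H r : nat)
    (net : combination_network H r) (M : R) (N B : nat) := UncodedScheme {
  placement : 'I_'C(H, r) -> seq ('I_N * 'I_B);
  placement_size : forall k, (size (placement k))%:R <= M * B%:R;
  relay_len : demands H r N -> 'I_H -> nat;
  relay_msg : forall (d : demands H r N) (h : 'I_H),
    files N B -> (relay_len d h).-tuple bool;
  user_len : demands H r N -> 'I_H -> 'I_'C(H, r) -> nat;
  user_msg : forall (d : demands H r N) (h : 'I_H) (k : 'I_'C(H, r)),
    (relay_len d h).-tuple bool -> (user_len d h k).-tuple bool;
  decoder : forall (d : demands H r N) (k : 'I_'C(H, r)),
    seq bool -> {ffun {h : 'I_H | h \in relays_of net k} -> seq bool} ->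
    B.-tuple bool }.

Arguments user_msg {R H r net M N B} u d h k _.

Section Scheme.
Variables (R : realType) (H r : nat) (net : combination_network H r).
Variables (M : R) (N B : nat) (S : uncoded_scheme net M N B).

Definition cache_content (k : 'I_'C(H, r)) (F : files N B) : seq bool :=
  [seq tnth (F p.1) p.2 | p <- placement S k].

Definition received (d : demands H r N) (k : 'I_'C(H, r)) (F : files N B) :
    {ffun {h : 'I_H | h \in relays_of net k} -> seq bool} :=
  [ffun h => tval (user_msg S d (sval h) k (relay_msg S d (sval h) F))].

Definition recovered (d : demands H r N) (k : 'I_'C(H, r)) (F : files N B) :
    B.-tuple bool :=
  decoder S d (cache_content k F) (received d k F).

(* Worst case over the demands; the N files are independent and uniform, i.e.
   uniformly distributed over [files N B]. *)
Definition error_probability : R :=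
  \big[Num.max/0]_(d : demands H r N)
    (#|[set F : files N B | [exists k, recovered d k F != F (d k)]]%SET|%:R
     / #|{: files N B}|%:R).

Definition relay_load (d : demands H r N) (h : 'I_H) : R :=
  (relay_len S d h)%:R / B%:R.

Definition user_load (d : demands H r N) (h : 'I_H) (k : 'I_'C(H, r)) : R :=
  (user_len S d h k)%:R / B%:R.

Definition max_link_load : R :=
  \big[Num.max/0]_(d : demands H r N) \big[Num.max/0]_(h : 'I_H)
    \big[Num.max/0]_(k in users_of net h)
      Num.max (relay_load d h) (user_load d h k).

Definition subfile (i : 'I_N) (W : {set 'I_'C(H, r)}) : {set 'I_B} :=
  [set b | [set k | (i, b) \in placement S k]%SET == W]%SET.

Definition subfile_size (W : {set 'I_'C(H, r)}) : R :=
  (\sum_(i < N) #|subfile i W|)%:R / (N%:R * B%:R).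

End Scheme.

Definition achieves (R : realType) (H r : nat) (net : combination_network H r)
    (M : R) (N : nat) (B : nat -> nat)
    (S : forall n, uncoded_scheme net M N (B n)) (L : R) : Prop :=
  [/\ B n @[n --> \oo] --> \oo,
      error_probability (S n) @[n --> \oo] --> (0 : R)
    & (limn_esup (fun n => (max_link_load (S n))%:E) <= L%:E)%E].

Definition optimal_load_uncoded (R : realType) (H r : nat)
    (net : combination_network H r) (M : R) (N : nat) : R :=
  inf [set L : R | exists (B : nat -> nat)
         (S : forall n, uncoded_scheme net M N (B n)), achieves S L].

Definition sequential_limit_point (R : realType) (T : Type) (u : nat -> T -> R)
    (x : T -> R) : Prop :=
  exists2 phi : nat -> nat, {homo phi : m n / (m < n)%N} &
    forall t, u (phi n) t @[n --> \oo] --> x t.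

(* Main.v *)
Require Import Defs.
From HB Require Import structures.
From mathcomp Require Import all_boot all_order all_algebra.
From mathcomp Require Import all_classical all_reals all_analysis.
From mathcomp Require Import ring.

Set Implicit Arguments.
Unset Strict Implicit.
Unset Printing Implicit Defensive.
Import Order.TTheory GRing.Theory Num.Theory.
Import numFieldNormedType.Exports.
Local Open Scope ring_scope.

(* Cut-set and acyclic-index-coding bound, done by counting instead of entropy.
   Let the users of K_Q decode in the order p with pairwise distinct demands.
   Given the messages of the relays in Q and all bits outside the set A of
   those demanded by some p_i and cached by none of p_1, ..., p_i, each user
   can form its cache from these bits and the previously decoded files, so all
   files are determined. Hence at most 2^(NB - |A| + sum of relay lengths)
   file vectors are decoded correctly by everyone, and as soon as the error
   probability is below 1/2 the lengths add up to at least |A|. Averaging |A|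
   over cyclically shifted demands gives the bound for each scheme; then let
   B tend to infinity along the subsequence. *)

Section FixedScheme.
Variables (R : realType) (H r : nat) (net : combination_network H r).
Variables (M : R) (N B : nat) (S : uncoded_scheme net M N B).
Implicit Types (d : demands H r N) (p : seq 'I_'C(H, r)) (F : files N B).
Implicit Types (W : {set 'I_'C(H, r)}) (J : {set 'I_H}).

(** * Sequential decoding and counting of correctly decoded file vectors *)

Definition cachers (q : 'I_N * 'I_B) : {set 'I_'C(H, r)} :=
  [set k | q \in placement S k]%SET.

Definition prefix_through p (k : 'I_'C(H, r)) : {set 'I_'C(H, r)} :=
  [set l in take (index k p).+1 p]%SET.

(* The bits that must be supplied by the relays when the users of [p] decode
   one after the other, each using the caches of its predecessors. *)
Definition uncached d p : {set 'I_N * 'I_B} :=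
  [set q | [exists k, [&& k \in p, d k == q.1
    & cachers q \subset ~: prefix_through p k]]]%SET.

Definition good_files d : {set files N B} :=
  [set F | [forall k, recovered S d k F == F (d k)]]%SET.

Lemma files_eqP (F F' : files N B) :
  (forall q, tnth (F q.1) q.2 = tnth (F' q.1) q.2) -> F = F'.
Proof.
by move=> eqF; apply/ffunP => i; apply: eq_from_tnth => b; apply: (eqF (i, b)).
Qed.

(** Induction on the position of a user in [p]: each bit it caches is either outside [uncached] or
    belongs to a file already decoded by a predecessor, and all its relays lie in [J], so both
    inputs of its decoder agree. *)
Lemma decoding_chain d p J F F' :
  (forall k, k \in p -> relays_of net k \subset J) ->
  F \in good_files d -> F' \in good_files d ->
  (forall q, q \notin uncached d p -> tnth (F q.1) q.2 = tnth (F' q.1) q.2) ->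
  (forall h, h \in J -> relay_msg S d h F = relay_msg S d h F') ->
  F = F'.
Proof.
move=> pJ; rewrite !inE => /forallP gF /forallP gF' eqA eqX.
suff chain k : k \in p -> F (d k) = F' (d k).
  apply: files_eqP => q; have [|/eqA//] := boolP (q \in uncached d p).
  by rewrite inE => /existsP[k /and3P[kp /eqP <- _]]; rewrite chain.
have [m] := ubnP (index k p); elim: m k => // m IHm k lt_k_m kp.
rewrite -(eqP (gF k)) -(eqP (gF' k)) /recovered; congr decoder.
  apply/eq_in_map => q qk; have [|/eqA//] := boolP (q \in uncached d p).
  (* No user in the prefix through [l] caches [q], while [k] does; hence [l] comes strictly before
     [k]. *)
  rewrite inE => /existsP[l /and3P[lp /eqP <- /fintype.subsetP/(_ k)]].
  rewrite !inE => /(_ qk); rewrite in_take// -leqNgt => lt_lk.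
  by rewrite IHm// (leq_trans lt_lk).
apply/ffunP => h; rewrite !ffunE; congr (tval (user_msg _ _ _ _ _)).
by apply: eqX; apply: (fintype.subsetP (pJ k kp)); apply: valP.
Qed.

Lemma card_good_files d p J :
  (forall k, k \in p -> relays_of net k \subset J) ->
  (#|good_files d| <=
   2 ^ (#|~: uncached d p| + \sum_(h in J) relay_len S d h))%N.
Proof.
move=> pJ.
pose A := {q | q \in ~: uncached d p}%SET.
pose X := {dffun forall h : {h | h \in J}, (relay_len S d (sval h)).-tuple bool}.
pose side F : {ffun A -> bool} * X :=
  ([ffun q => tnth (F (sval q).1) (sval q).2],
   [ffun h => relay_msg S d (sval h) F]).
have side_inj : {in good_files d &, injective side}.
  move=> F F' gF gF' [/ffunP eqA /ffunP eqX].
  apply: (decoding_chain pJ gF gF') => [q qA | h hJ].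
    have qC : q \in (~: uncached d p)%SET by rewrite inE.
    by have := eqA (exist _ q qC); rewrite !ffunE.
  by have := eqX (exist _ h hJ); rewrite !ffunE.
have le_card := leq_card_in _ _ side_inj.
apply: (leq_trans le_card).
rewrite card_prod card_ffun card_bool card_sig expnD.
apply: leq_mul.
  by rewrite leq_exp2l// subset_leq_card//; apply/fintype.subsetP => q.
rewrite card_dep_ffun foldrE big_map big_enum [X in (_ <= 2 ^ X)%N]big_sub expn_sum /=.
by apply: leq_prod => h _; rewrite card_tuple card_bool.
Qed.

Lemma card_files : #|{: files N B}| = (2 ^ (N * B))%N.
Proof. by rewrite card_ffun card_tuple card_bool card_ord -expnM mulnC. Qed.

Lemma error_probability_ge d :
  1 - #|good_files d|%:R / #|{: files N B}|%:R <= error_probability S.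
Proof.
have files_gt0 : 0 < #|{: files N B}|%:R :> R.
  by rewrite card_files ltr0n expn_gt0.
apply: le_trans (le_bigmax _ _ d).
rewrite ler_pdivlMr// mulrBl mul1r divfK ?gt_eqF// -natrB ?max_card// ler_nat.
rewrite -[X in (X - _)%N](cardsC (good_files d)) addKn subset_leq_card//.
apply/fintype.subsetP => F; rewrite !inE negb_forall => /existsP[k bad_k].
by apply/existsP; exists k.
Qed.

(* A success probability above 1/2 already rules out any rate loss: there are
   then more good files than half of the [2 ^ (N * B)] ones. *)
Lemma card_uncached_le d p J :
  (forall k, k \in p -> relays_of net k \subset J) ->
  error_probability S < 2^-1 ->
  (#|uncached d p| <= \sum_(h in J) relay_len S d h)%N.
Proof.
move=> pJ err_lt; rewrite leqNgt; apply/negP => lt_len.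
have := le_lt_trans (error_probability_ge d) err_lt; apply/negP; rewrite -leNgt.
have -> : 2^-1 = 1 - 2^-1 :> R by field.
rewrite lerD2l lerN2 ler_pdivrMr ?card_files ?ltr0n ?expn_gt0//.
rewrite mulrC ler_pdivlMr// -natrM ler_nat.
apply: leq_trans (leq_mul (card_good_files d pJ) (leqnn 2)) _.
(* The factor 2 costs one unit in the exponent, which the strict inequality [lt_len] supplies. *)
rewrite -expnSr leq_exp2l// -addnS.
apply: leq_trans (leq_add (leqnn _) lt_len) _.
by rewrite addnC cardsC card_prod !card_ord.
Qed.

(** * From bit counts to subfile sizes *)

Lemma card_bits_cached_in (i : 'I_N) (V : {set 'I_'C(H, r)}) :
  #|[set b | cachers (i, b) \subset V]%SET|
  = (\sum_(W : {set 'I_'C(H, r)} | W \subset V) #|subfile S i W|)%N.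
Proof.
rewrite -sum1_card.
rewrite (partition_big (fun b => cachers (i, b)) (fun W => W \subset V)) /=.
  apply: eq_bigr => W WV; rewrite -sum1_card; apply: eq_bigl => b.
  by rewrite !inE; case: eqP => [->|]; rewrite ?WV ?andbF.
by move=> b; rewrite inE.
Qed.

(** Distinct demands put the bits counted for different users in different files, so no bit is
    counted twice. *)
Lemma sum_subfile_le_card_uncached d p : injective d -> uniq p ->
  (\sum_(k <- p) \sum_(W : {set 'I_'C(H, r)} | W \subset ~: prefix_through p k)
     #|subfile S (d k) W| <= #|uncached d p|)%N.
Proof.
move=> d_inj p_uniq.
have -> : #|uncached d p| =
    (\sum_j #|[set b | (j, b) \in uncached d p]%SET|)%N.
  under eq_bigr do rewrite -sum1dep_card.
  by rewrite pair_big_dep -sum1_card; apply: eq_bigl => -[j b].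
rewrite (bigID (mem [set d k | k in p]%SET)) /= -[leqLHS]addn0 leq_add//.
rewrite big_imset /=; last by move=> k l _ _; apply: d_inj.
rewrite -big_uniq// !big_seq; apply: leq_sum => k kp.
rewrite -card_bits_cached_in subset_leq_card//.
apply/fintype.subsetP => b; rewrite !inE => b_out.
by apply/existsP; exists k; rewrite kp eqxx.
Qed.

Lemma relay_len_le d (h : 'I_H) (k : 'I_'C(H, r)) :
  h \in relays_of net k -> (0 < B)%N ->
  (relay_len S d h)%:R <= max_link_load S * B%:R.
Proof.
move=> hk B_gt0; rewrite -ler_pdivrMr ?ltr0n//.
apply: le_trans (le_bigmax _ _ d); apply: le_trans (le_bigmax _ _ h).
have kh : k \in users_of net h by rewrite inE.
by apply: le_trans (le_bigmax_cond _ _ kh); rewrite le_max lexx.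
Qed.

Lemma sum_subfile_demanded_le d p (Q : {set 'I_H}) :
  injective d -> uniq p -> (forall k, k \in p -> relays_of net k \subset Q) ->
  (0 < B)%N -> error_probability S < 2^-1 ->
  (\sum_(k <- p) \sum_(W : {set 'I_'C(H, r)} | W \subset ~: prefix_through p k)
     #|subfile S (d k) W|)%:R <= #|Q|%:R * (max_link_load S * B%:R).
Proof.
move=> d_inj p_uniq pQ B_gt0 err_lt.
(* Taking only relays attached to a user of [p], instead of all of [Q], gives each relay a witness
   user, as [relay_len_le] requires. *)
pose J := (\bigcup_(k in p) relays_of net k)%SET.
have pJ k : k \in p -> relays_of net k \subset J.
  by move=> kp; apply: finset.bigcup_sup.
have le_len : (#|uncached d p| <= \sum_(h in J) relay_len S d h)%N.
  exact: card_uncached_le.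
have load_ge0 : 0 <= max_link_load S * B%:R.
  by rewrite mulr_ge0// bigmax_ge_id.
apply: (@le_trans _ _ (\sum_(h in J) (max_link_load S * B%:R))); last first.
  rewrite sumr_const -[leLHS]mulr_natl ler_wpM2r// ler_nat subset_leq_card//.
  by apply/bigcupsP.
apply: (@le_trans _ _ (\sum_(h in J) (relay_len S d h)%:R)); last first.
  by apply: ler_sum => h /bigcupP[k _ hk]; apply: relay_len_le hk B_gt0.
rewrite -natr_sum ler_nat; apply: leq_trans le_len.
exact: sum_subfile_le_card_uncached.
Qed.

(** The subfiles partition the bit positions by their sets of cachers; normalization and the memory
    constraint are two choices of [P]. *)
Lemma sum_subfile_size_cond (P : pred {set 'I_'C(H, r)}) :
  \sum_(W : {set 'I_'C(H, r)} | P W) subfile_size S W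
  = #|[set q | P (cachers q)]%SET|%:R / (N%:R * B%:R).
Proof.
rewrite -mulr_suml -natr_sum; congr (_%:R / _).
rewrite -sum1_card (partition_big cachers P) /=; last by move=> q; rewrite inE.
apply: eq_bigr => W PW.
under eq_bigr do rewrite -sum1_card.
rewrite pair_big_dep; apply: eq_bigl => -[j b] /=.
by rewrite !inE /cachers; case: eqP => [->|]; rewrite ?PW ?andbF.
Qed.

Lemma sum_subfile_size : (0 < N)%N -> (0 < B)%N ->
  \sum_(W : {set 'I_'C(H, r)}) subfile_size S W = 1.
Proof.
move=> N_gt0 B_gt0; rewrite (sum_subfile_size_cond xpredT).
have -> : [set q : 'I_N * 'I_B | true]%SET = [set: _]%SET.
  by apply/finset.setP => q; rewrite !inE.
rewrite cardsT card_prod !card_ord -natrM divff// pnatr_eq0 -lt0n.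
by rewrite muln_gt0 N_gt0.
Qed.

Lemma sum_subfile_size_cached (k : 'I_'C(H, r)) : (0 < B)%N ->
  \sum_(W : {set 'I_'C(H, r)} | k \in W) subfile_size S W <= M / N%:R.
Proof.
move=> B_gt0; rewrite (sum_subfile_size_cond (fun W => k \in W)).
rewrite invfM mulrA mulrAC ler_wpM2r ?invr_ge0// ler_pdivrMr ?ltr0n//.
apply: le_trans (placement_size S k); rewrite ler_nat.
(* Only an inequality, since [placement] may repeat positions. *)
apply: leq_trans (card_size _); apply: subset_leq_card.
by apply/fintype.subsetP => q; rewrite !inE.
Qed.

End FixedScheme.

(* Averaging over the [N] demands [k |-> k + s mod N], which are injective
   because there are at most [N] users: every user demands every file once. *)
Lemma sum_subfile_size_le (R : realType) (H r N B : nat) (M : R)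
    (net : combination_network H r) (S : uncoded_scheme net M N B)
    (p : seq 'I_'C(H, r)) (Q : {set 'I_H}) :
  ('C(H, r) <= N)%N -> (0 < N)%N -> (0 < B)%N ->
  uniq p -> (forall k, k \in p -> relays_of net k \subset Q) ->
  error_probability S < 2^-1 ->
  \sum_(k <- p) \sum_(W : {set 'I_'C(H, r)} | W \subset ~: prefix_through p k)
     subfile_size S W <= #|Q|%:R * max_link_load S.
Proof.
case: N S => // N S K_le_N _ B_gt0 p_uniq pQ err_lt.
pose shift (s : 'I_N.+1) : demands H r N.+1 := [ffun k => widen_ord K_le_N k + s].
have shift_inj s : injective (shift s).
  move=> k l; rewrite !ffunE => /addIr /(congr1 val) /= kl; exact: val_inj.
have sum_shift k W :
    (\sum_s #|subfile S (shift s k) W| = \sum_i #|subfile S i W|)%N.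
  rewrite [RHS](reindex_inj (addrI (widen_ord K_le_N k))).
  by apply: eq_bigr => s _; rewrite ffunE.
under eq_bigr do rewrite -mulr_suml -natr_sum.
rewrite -mulr_suml -natr_sum.
rewrite ler_pdivrMr ?mulr_gt0 ?ltr0n//.
under eq_bigr => k _.
  rewrite -(eq_bigr _ (fun W _ => sum_shift k W)) exchange_big /=.
  over.
rewrite exchange_big /= natr_sum.
have -> : #|Q|%:R * max_link_load S * (N.+1%:R * B%:R)
    = \sum_(s < N.+1) #|Q|%:R * (max_link_load S * B%:R).
  by rewrite sumr_const card_ord -mulr_natl; ring.
by apply: ler_sum => s _; apply: sum_subfile_demanded_le.
Qed.

(** Passes from prefixes indexed by users to prefixes indexed by positions, the form used in the
    theorem. *)
Lemma big_prefix (V : nmodType) (T : eqType) (p : seq T) (f : seq T -> V) :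
  uniq p -> \sum_(k <- p) f (take (index k p).+1 p)
            = \sum_(i < size p) f (take i.+1 p).
Proof.
case: p => [|x0 p']; first by rewrite big_nil big_ord0.
move: (x0 :: p') => p p_uniq; rewrite (big_nth x0) big_mkord.
by apply: eq_bigr => i _; rewrite index_uniq.
Qed.

(** * Limits along the subsequence *)

Lemma homo_ltn_cvgy (phi : nat -> nat) :
  {homo phi : m n / (m < n)%N} -> (phi n @[n --> \oo] --> \oo)%classic.
Proof.
move=> phi_lt; have le_phi n : (n <= phi n)%N.
  by elim: n => // n /leq_ltn_trans; apply; apply: phi_lt.
move=> A [m _ mA]; exists m => // n /= mn; apply: mA => /=.
exact: leq_trans mn (le_phi n).
Qed.

(** The limsup is the infimum, over neighbourhoods of infinity, of suprema; some neighbourhood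
    already has supremum below [l']. *)
Lemma limn_esup_near_lt (R : realType) (u : nat -> R) (l l' : R) :
  (limn_esup (fun n => (u n)%:E) <= l%:E)%E -> l < l' ->
  \forall n \near \oo%classic, u n < l'.
Proof.
move=> u_le ll'; have : (limn_esup (fun n => (u n)%:E) < l'%:E)%E.
  by apply: le_lt_trans u_le _; rewrite lte_fin.
move=> /ereal_inf_lt[_ [V V_oo <-] sup_lt].
apply: filterS V_oo => n Vn; rewrite -lte_fin; apply: le_lt_trans sup_lt.
by apply: ereal_sup_ubound; exists n.
Qed.

Theorem theorem4 (R : realType) (H r N : nat) (M : R)
    (net : combination_network H r)
    (r_bounds : (1 <= r <= H)%N) (M_bounds : 0 <= M <= N%:R)
    (N_ge_K : ('C(H, r) <= N)%N)
    (B : nat -> nat) (S : forall n, uncoded_scheme net M N (B n))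
    (S_optimal : achieves S (optimal_load_uncoded net M N))
    (x : {set 'I_'C(H, r)} -> R)
    (x_limit : sequential_limit_point (fun n => subfile_size (S n)) x) :
  [/\ forall (Q : {set 'I_H}) (p : seq 'I_'C(H, r)),
        (r <= #|Q| <= H)%N -> perm_eq p (enum (users_within net Q)) ->
        \sum_(i < #|users_within net Q|)
          \sum_(W : {set 'I_'C(H, r)}
                | W \subset ~: [set k in take i.+1 p]%SET) x W
        <= #|Q|%:R * optimal_load_uncoded net M N,
      \sum_(W : {set 'I_'C(H, r)}) x W = 1
    & forall i : 'I_'C(H, r),
        \sum_(W : {set 'I_'C(H, r)} | i \in W) x W <= M / N%:R].
Proof.
have [/andP[_ r_le_H] [B_oo err0 load_le]] := (r_bounds, S_optimal).
have N_gt0 : (0 < N)%N by rewrite (leq_trans _ N_ge_K)// bin_gt0.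
case: x_limit => phi /homo_ltn_cvgy phi_oo x_lim.
(* At [B = 0] division by zero makes every [subfile_size] vanish, so positivity is secured
   eventually. *)
have B_gt0 : \forall n \near \oo%classic, (0 < B (phi n))%N.
  by apply: (phi_oo _ (B_oo [set m | (0 < m)%N]%classic _)); exists 1%N.
have sum_lim (P : pred {set 'I_'C(H, r)}) :
    ((\sum_(W : {set 'I_'C(H, r)} | P W) subfile_size (S (phi n)) W)%R
       @[n --> \oo] --> (\sum_(W : {set 'I_'C(H, r)} | P W) x W)%R)%classic.
  by apply: (cvg_big add_continuous) => W _; apply: x_lim.
split=> [Q p _ p_perm||k].
- have p_uniq : uniq p by rewrite (perm_uniq p_perm) enum_uniq.
  have pQ k : k \in p -> relays_of net k \subset Q.
    by rewrite (perm_mem p_perm) mem_enum inE.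
  rewrite cardE -(perm_size p_perm).
  rewrite -(big_prefix (fun s =>
    \sum_(W : {set _} | W \subset ~: [set k in s]%SET) x W))//.
  apply/ler_addgt0Pr => e e_gt0.
  pose L := optimal_load_uncoded net M N.
  have Q1_gt0 : 0 < #|Q|.+1%:R :> R by rewrite ltr0n.
  (* After multiplication by [#|Q|] this slack costs at most [e]; the successor keeps the
     denominator nonzero. *)
  pose L' := L + e / #|Q|.+1%:R.
  have LL' : L < L' by rewrite ltrDl divr_gt0.
  have le_e : #|Q|%:R * L' <= #|Q|%:R * L + e.
    rewrite mulrDr lerD2l mulrCA ler_piMr ?(ltW e_gt0)//.
    by rewrite ler_pdivrMr// mul1r ler_nat.
  apply: le_trans le_e.
  have load_lt := phi_oo _ (limn_esup_near_lt load_le LL').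
  have err_lt : \forall n \near \oo%classic, error_probability (S n) < 2^-1.
    by apply: (cvgr_lt _ err0); rewrite invr_gt0.
  have {}err_lt := phi_oo _ err_lt.
  have {}sum_lim : ((\sum_(k <- p)
      \sum_(W : {set 'I_'C(H, r)} | W \subset ~: prefix_through p k)
        subfile_size (S (phi n)) W)%R @[n --> \oo%classic] -->
      (\sum_(k <- p)
        \sum_(W : {set 'I_'C(H, r)} | W \subset ~: prefix_through p k) x W)%R)%classic.
    by apply: (cvg_big add_continuous) => k _; apply: sum_lim.
  apply: (cvgr_to_le sum_lim).
  near=> n; apply: (@le_trans _ _ (#|Q|%:R * max_link_load (S (phi n)))).
    apply: sum_subfile_size_le => //; first by near: n.
    by near: n.
  by rewrite ler_wpM2l// ltW//; near: n.
- apply: (cvg_unique _ (sum_lim xpredT)) => //.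
  apply: cvg_near_cst; apply: filterS B_gt0 => n Bn_gt0.
  exact: sum_subfile_size.
- apply: (cvgr_to_le (sum_lim _)); apply: filterS B_gt0 => n.
  exact: sum_subfile_size_cached.
Unshelve. all: by end_near.
Qed.
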